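(* Let $A$ be a finite alphabet with $|A|\ge 2$. The problem of deciding, given a system $(\mathcal S,\mathcal U)$ of sat- and unsat-equations over $A$, whether $(\mathcal S,\mathcal U)$ is satisfiable over $A$, is undecidable.
   Context: Let $X$ and $Y$ be disjoint alphabets of variables (disjoint from $A$). A system of sat- and unsat-equations over $A$ is a pair $(\mathcal S,\mathcal U)$ of finite sets $\mathcal S=\{e_1,\ldots,e_n\}$, $\mathcal U=\{f_1,\ldots,f_m\}$, where each $e_i$ is $U_i=V_i$ or $\lnot(U_i=V_i)$ with $U_i,V_i\in(A\cup X)^*$, and each $f_i$ is $U_i'=V_i'$ or $\lnot(U_i'=V_i')$ with $U_i',V_i'\in(A\cup X\cup Y)^*$. It is satisfiable over $A$ if there is an assignment of the variables of $X$ to words of $A^*$ that satisfies all $e_i\in\mathcal S$ and such that for all assignments of the variables of $Y$ to words of $A^*$ at least one $f_j\in\mathcal U$ is not satisfied. (An assignment is extended to a morphism fixing every letter of $A$; it satisfies $U=V$ if the images of $U$ and $V$ are equal.) *)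

(* Defs.v *)
From HB Require Import structures.
From mathcomp Require Import all_boot.

Set Implicit Arguments.
Unset Strict Implicit.
Unset Printing Implicit Defensive.

(** * Word equations with variables *)

(* A word of (A ∪ V)^*, for an alphabet A and a disjoint set V of variables. *)
Definition pattern (A V : Type) := seq (A + V).

Inductive literal (A V : Type) :=
  | EqLit of pattern A V & pattern A V    (* U = V *)
  | NeqLit of pattern A V & pattern A V.  (* ~ (U = V) *)

Definition subst (A V : Type) (h : V -> seq A) (u : pattern A V) : seq A :=
  flatten [seq match z with inl a => [:: a] | inr v => h v end | z <- u].

Definition satisfies (A : eqType) (V : Type) (h : V -> seq A)
    (e : literal A V) : bool :=
  match e with
  | EqLit u v => subst h u == subst h v
  | NeqLit u v => subst h u != subst h v
  end.

(* The variables of X and of Y are both named by natural numbers; X ∪ Y is the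
   disjoint sum. The finite sets of literals are presented by lists; neither
   the order nor repetitions matter for satisfiability. *)
Definition xvar := nat.
Definition yvar := nat.

Record system (A : Type) := System {
  sat_eqs : seq (literal A xvar);
  unsat_eqs : seq (literal A (xvar + yvar))
}.

Definition join (A : Type) (x : xvar -> seq A) (y : yvar -> seq A)
    (v : xvar + yvar) : seq A :=
  match v with inl i => x i | inr j => y j end.

Definition satisfiable (A : eqType) (s : system A) : Prop :=
  exists x : xvar -> seq A,
    all (satisfies x) (sat_eqs s) /\
    forall y : yvar -> seq A,
      has (fun f => ~~ satisfies (join x y) f) (unsat_eqs s).

(** * Turing machines

    Deterministic machines with one two-way infinite tape. The tape alphabet
    is option (Sigma + work): blank (None), input symbols and work symbols. *)

Inductive direction := MoveL | MoveR.

Record turing_machine (Sigma : finType) := TuringMachine {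
  state : finType;
  work : finType;
  start : state;
  accept : state;
  reject : state;
  accept_neq_reject : accept != reject;
  delta : state -> option (Sigma + work) ->
          state * option (Sigma + work) * direction
}.

Section Runs.
Variables (Sigma : finType) (M : turing_machine Sigma).

Notation tape_symbol := (option (Sigma + work M)).

(* The head scans the first symbol of tape_right; tape_left is listed from the
   head outwards; the cells beyond both lists are blank. *)
Record config := Config {
  current : state M;
  tape_left : seq tape_symbol;
  tape_right : seq tape_symbol
}.

Definition init (w : seq Sigma) : config :=
  Config (start M) [::] [seq Some (inl a) | a <- w].

Definition halted (c : config) : bool :=
  (current c == accept M) || (current c == reject M).

Definition step (c : config) : config :=
  if halted c then c else
  let: Config q l r := c in
  let: (q', b, d) := delta q (head None r) in
  match d with
  | MoveR => Config q' (b :: l) (behead r)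
  | MoveL => Config q' (behead l) (head None l :: b :: behead r)
  end.

Definition accepts (w : seq Sigma) : Prop :=
  exists n, current (iter n step (init w)) = accept M.

Definition rejects (w : seq Sigma) : Prop :=
  exists n, current (iter n step (init w)) = reject M.

End Runs.

(* The instances of the problem are the elements of I, given to the machine
   through their codes; nothing is required on words that are not codes. *)
Definition turing_decidable (Sigma : finType) (I : Type)
    (code : I -> seq Sigma) (P : I -> Prop) : Prop :=
  exists M : turing_machine Sigma, forall i : I,
    (P i -> accepts M (code i)) /\ (~ P i -> rejects M (code i)).

(** * Systems as input words

    The letters of A are written as themselves, and the n-th variable of X
    (resp. Y) as MX (resp. MY) followed by n ticks. A literal is written
    U MEq V MEnd or U MNeq V MEnd. The sat- and the unsat-equations are listed
    one after the other, separated by MBar. *)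

Inductive marker := MX | MY | MTick | MEq | MNeq | MEnd | MBar.

Definition marker_index (m : marker) : 'I_7 :=
  match m with
  | MX => @Ordinal 7 0 isT | MY => @Ordinal 7 1 isT
  | MTick => @Ordinal 7 2 isT | MEq => @Ordinal 7 3 isT
  | MNeq => @Ordinal 7 4 isT | MEnd => @Ordinal 7 5 isT
  | MBar => @Ordinal 7 6 isT
  end.

Definition index_marker (i : 'I_7) : marker :=
  nth MX [:: MX; MY; MTick; MEq; MNeq; MEnd; MBar] i.

Lemma marker_indexK : cancel marker_index index_marker.
Proof. by case. Qed.

HB.instance Definition _ := Finite.copy marker (can_type marker_indexK).

Section Code.
Variable A : finType.

Notation symbol := (A + marker)%type.

Definition code_xvar (n : xvar) : seq symbol :=
  inr MX :: nseq n (inr MTick).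

Definition code_xyvar (v : xvar + yvar) : seq symbol :=
  match v with
  | inl n => code_xvar n
  | inr n => inr MY :: nseq n (inr MTick)
  end.

Definition code_pattern (V : Type) (code_var : V -> seq symbol)
    (u : pattern A V) : seq symbol :=
  flatten [seq match z with inl a => [:: inl a] | inr v => code_var v end
          | z <- u].

Definition code_literal (V : Type) (code_var : V -> seq symbol)
    (e : literal A V) : seq symbol :=
  match e with
  | EqLit u v => code_pattern code_var u ++ inr MEq ::
                 code_pattern code_var v ++ [:: inr MEnd]
  | NeqLit u v => code_pattern code_var u ++ inr MNeq ::
                  code_pattern code_var v ++ [:: inr MEnd]
  end.

Definition code_system (s : system A) : seq symbol :=
  flatten [seq code_literal code_xvar e | e <- sat_eqs s] ++ inr MBar ::
  flatten [seq code_literal code_xyvar f | f <- unsat_eqs s].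

(* Sanity check: distinct systems have distinct codes. *)

Let stop (z : symbol) :=
  if z is inr m then m \in [:: MEq; MNeq; MEnd; MBar] else false.

Let no_tick (s : seq symbol) := if s is inr MTick :: _ then false else true.

Let unique_read (V : Type) (code_var : V -> seq symbol) :=
  (forall v s s', no_tick s -> no_tick s' ->
     forall v', code_var v ++ s = code_var v' ++ s' -> v = v' /\ s = s') /\
  (forall v, exists m t,
     code_var v = inr m :: t /\ m \in [:: MX; MY]).

Let nseq_tick_inj n n' s s' : no_tick s -> no_tick s' ->
  nseq n (inr MTick) ++ s = nseq n' (inr MTick) ++ s' -> n = n' /\ s = s'.
Proof.
move=> hs hs'; elim: n n' => [|n IH] [|n'] //=.
- by move=> e; rewrite e in hs.
- by move=> e; rewrite -e in hs'.
- by case=> /IH [-> ->].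
Qed.

Let unique_read_xvar : unique_read code_xvar.
Proof.
split=> [n s s' hs hs' n' [] | n]; first exact: nseq_tick_inj.
by exists MX, (nseq n (inr MTick)).
Qed.

Let unique_read_xyvar : unique_read code_xyvar.
Proof.
split=> [[n|n] s s' hs hs' [n'|n'] //= []|[n|n]].
- by move/(nseq_tick_inj hs hs') => -[-> ->].
- by move/(nseq_tick_inj hs hs') => -[-> ->].
- by exists MX, (nseq n (inr MTick)).
- by exists MY, (nseq n (inr MTick)).
Qed.

Section Unique.
Variables (V : Type) (code_var : V -> seq symbol).
Hypothesis cP : unique_read code_var.

Let no_tick_pattern u z s : stop z -> no_tick (code_pattern code_var u ++ z :: s).
Proof.
case: u => [|[a|v] u] //; first by case: z => [|[]].
rewrite /code_pattern /=; have [m [t [-> hm]]] := cP.2 v.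
by case: m hm.
Qed.

Let code_pattern_inj u u' z z' s s' : stop z -> stop z' ->
  code_pattern code_var u ++ z :: s = code_pattern code_var u' ++ z' :: s' ->
  [/\ u = u', z = z' & s = s'].
Proof.
move=> hz hz'; elim: u u' => [|[a|v] u IH] [|[a'|v'] u'] //=.
- by case=> -> ->.
- by case=> e; rewrite e in hz.
- have [m [t [et hm]]] := cP.2 v'.
  by rewrite /code_pattern /= et => -[e _]; rewrite e in hz; case: m hm hz {et e}.
- by case=> e; rewrite -e in hz'.
- by case=> -> /IH [-> -> ->].
- by have [m [t [et hm]]] := cP.2 v'; rewrite /code_pattern /= et.
- have [m [t [et hm]]] := cP.2 v.
  rewrite /code_pattern /= et => -[e _].
  by rewrite -e in hz'; case: m hm hz' {et e}.
- by have [m [t [et hm]]] := cP.2 v; rewrite /code_pattern /= et.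
- rewrite /code_pattern /= -!catA => /cP.1 [].
  + exact: no_tick_pattern.
  + exact: no_tick_pattern.
  + by move=> -> /IH [-> -> ->].
Qed.

Let code_literal_inj e e' s s' :
  code_literal code_var e ++ s = code_literal code_var e' ++ s' ->
  e = e' /\ s = s'.
Proof.
case: e e' => u v [] u' v' /=; rewrite -!catA /= -!catA /=;
  case/code_pattern_inj => // -> // _;
  by case/code_pattern_inj => // -> _ ->.
Qed.

Let code_literal_start e s :
  exists z t, code_literal code_var e ++ s = z :: t /\ z <> inr MBar.
Proof.
case: e => -[|[a|x] u] v; rewrite /code_literal /code_pattern /=;
  try (by eexists; eexists; split; [reflexivity|]);
  have [m [t [-> hm]]] := cP.2 x;
  by eexists; eexists; split; [reflexivity|]; case: m hm.
Qed.

Lemma code_literals_inj l l' s s' :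
  (if s is z :: _ then z == inr MBar else true) ->
  (if s' is z :: _ then z == inr MBar else true) ->
  flatten [seq code_literal code_var e | e <- l] ++ s =
  flatten [seq code_literal code_var e | e <- l'] ++ s' -> l = l' /\ s = s'.
Proof.
move=> hs hs'; elim: l l' => [|e l IH] [|e' l'] //=; rewrite -?catA.
- have [z [t [-> hz]]] := code_literal_start e'
    (flatten [seq code_literal code_var e | e <- l'] ++ s').
  by move=> E; rewrite E in hs; move/eqP: hs.
- have [z [t [-> hz]]] := code_literal_start e
    (flatten [seq code_literal code_var e | e <- l] ++ s).
  by move=> E; rewrite -E in hs'; move/eqP: hs'.
- by case/code_literal_inj=> -> /IH [-> ->].
Qed.

End Unique.

Lemma code_system_inj : injective code_system.
Proof.
move=> [l u] [l' u']; rewrite /code_system /=.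
case/(code_literals_inj unique_read_xvar) => // -> [E].
rewrite -[flatten _]cats0 -[RHS]cats0 in E.
by case/(code_literals_inj unique_read_xyvar): E => // ->.
Qed.

End Code.

(* Main.v *)
Require Import Defs.
From mathcomp Require Import all_boot zify.

(** A fixed point replaces a reduction. Given a machine M deciding the problem, we
    build a system that is satisfiable exactly if M rejects its code.

    The first literal of the system is a^n = x, so that its code is a^n w with w
    independent of n, and we let n be the number having w as its word of digits.
    A two-stack machine with stacks L and R stored as numbers starts from
    L = R = n: it pushes the letter a on R once for each unit of L, which turns R
    into the number of the code a^n w, and then simulates M.

    A run of this machine is a word in a and b, namely a list of numbers written
    as the lengths of the blocks of a's. That two consecutive configurations are
    related by no rule is the existence of values for Y satisfying a conjunction
    of equations and inequations, in which almost all variables of Y are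
    restricted to powers of a. *)

Set Implicit Arguments.
Unset Strict Implicit.
Unset Printing Implicit Defensive.

(** * Words in two letters as lists of block lengths *)

Section Blocks.
Variables (A : eqType) (a b : A).

Definition blocks (ns : seq nat) : seq A :=
  flatten [seq b :: nseq n a | n <- ns].

Lemma blocks_cat ns ns' : blocks (ns ++ ns') = blocks ns ++ blocks ns'.
Proof. by rewrite /blocks map_cat flatten_cat. Qed.

Lemma blocks_cons n ns : blocks (n :: ns) = b :: nseq n a ++ blocks ns.
Proof. by []. Qed.

Hypothesis ab : a != b.

Lemma nseq_blocks_inj n n' ns ns' :
  nseq n a ++ blocks ns = nseq n' a ++ blocks ns' -> n = n' /\ ns = ns'.
Proof.
have ba := negbTE ab.
elim: ns n n' ns' => [|k ns IH]; elim=> [|n IHn] [|n'] [|k' ns'] //=;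
  try (by case=> /IHn [-> E]); rewrite ?blocks_cons //;
  try (by move/eqP; rewrite eqseq_cons ?ba // eq_sym ba).
by case=> /IH [-> ->].
Qed.

Lemma blocks_inj : injective blocks.
Proof. by move=> ns ns' E; have [] := @nseq_blocks_inj 0 0 _ _ E. Qed.

Lemma mem_blocks ns : {subset blocks ns <= [:: a; b]}.
Proof.
move=> c /flattenP [s /mapP [n _ ->]]; rewrite !inE mem_nseq.
by case/orP=> [->|/andP [_ ->]]; rewrite ?orbT.
Qed.

Lemma nseq_blocks_ex w :
  {subset w <= [:: a; b]} -> exists k ns, w = nseq k a ++ blocks ns.
Proof.
elim: w => [|c w IH] sw; first by exists 0, [::].
have [|k [ns ->]] := IH; first by move=> x xw; apply: sw; rewrite inE xw orbT.
have := sw c; rewrite !inE eqxx => /(_ isT) /orP [] /eqP ->.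
  by exists k.+1, ns.
by exists 0, (k :: ns).
Qed.

Lemma blocks_ex w :
  {subset w <= [:: a; b]} -> exists k ns, b :: w = blocks (k :: ns).
Proof. by move=> /nseq_blocks_ex [k [ns ->]]; exists k, ns. Qed.

(** Commuting with [a] is thus an equation that confines a variable to the powers of [a]. *)
Lemma commute_letter (u : seq A) : u ++ [:: a] = a :: u -> u = nseq (size u) a.
Proof. by elim: u => //= c u IH [-> /IH {1}->]. Qed.

Lemma nseq_commute n : nseq n a ++ [:: a] = a :: nseq n a.
Proof. by elim: n => //= n ->. Qed.

End Blocks.

(** * Images of patterns under assignments *)

Lemma subst_nil (A V : Type) (h : V -> seq A) : subst h [::] = [::].
Proof. by []. Qed.

Lemma subst_letter (A V : Type) (h : V -> seq A) c u :
  subst h (inl c :: u) = c :: subst h u.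
Proof. by []. Qed.

Lemma subst_var (A V : Type) (h : V -> seq A) v u :
  subst h (inr v :: u) = h v ++ subst h u.
Proof. by []. Qed.

Lemma subst_cat (A V : Type) (h : V -> seq A) u v :
  subst h (u ++ v) = subst h u ++ subst h v.
Proof. by rewrite /subst map_cat flatten_cat. Qed.

Lemma subst_letters (A V : Type) (h : V -> seq A) w :
  subst h [seq inl c | c <- w] = w.
Proof. by elim: w => //= c w IH; rewrite subst_letter IH. Qed.

Lemma subst_nseq_letter (A V : Type) (h : V -> seq A) n c :
  subst h (nseq n (inl c)) = nseq n c.
Proof. by elim: n => //= n IH; rewrite subst_letter IH. Qed.

Lemma subst_nseq_var (A V : Type) (h : V -> seq A) n v c k :
  h v = nseq k c -> subst h (nseq n (inr v)) = nseq (n * k) c.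
Proof.
by move=> hv; elim: n => //= n IH; rewrite subst_var IH hv mulSn nseqD.
Qed.

Definition substE := (subst_nil, subst_letter, subst_var, subst_cat,
                      subst_letters, subst_nseq_letter).

(** * Rules, configurations and histories *)

(* A rule relates (s, L, R) to (s', L', R') when, for two pairs of a state and
   two linear forms n * v + k in one of L, R, L', R', the first pair evaluates to
   (s, L, R) and the second one to (s', L', R').  Allowing L' and R' on the left
   makes division by a constant expressible. *)
Definition rule_var := (bool * bool)%type.
Definition OldL : rule_var := (false, false).
Definition OldR : rule_var := (false, true).
Definition NewL : rule_var := (true, false).
Definition NewR : rule_var := (true, true).

Definition form := (rule_var * nat * nat)%type.
Definition rule := ((nat * form * form) * (nat * form * form))%type.
Definition conf := (nat * nat * nat)%type.

Definition rule_env (T : Type) (L R L' R' : T) (v : rule_var) : T :=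
  if v.1 then if v.2 then R' else L' else if v.2 then R else L.

Definition form_val (v : rule_var -> nat) (f : form) : nat :=
  f.1.2 * v f.1.1 + f.2.

Definition side_val (v : rule_var -> nat) (r : nat * form * form) : conf :=
  (r.1.1, form_val v r.1.2, form_val v r.2).

Definition fires (c c' : conf) (r : rule) : bool :=
  let v := rule_env c.1.2 c.2 c'.1.2 c'.2 in
  (c == side_val v r.1) && (c' == side_val v r.2).

Definition moves (rules : seq rule) (c c' : conf) : bool :=
  has (fires c c') rules.

(* A history c_0, ..., c_n is stored as the numbers m + s, L, R of its
   configurations (s, L, R); being larger than all L and R, m marks the
   beginning of a configuration. *)
Definition history (m : nat) (cs : seq conf) : seq nat :=
  flatten [seq [:: m + c.1.1; c.1.2; c.2] | c <- cs].

Lemma history_cat m cs cs' :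
  history m (cs ++ cs') = history m cs ++ history m cs'.
Proof. by rewrite /history map_cat flatten_cat. Qed.

(* The window is aligned with the configurations, since an L or an R is never
   at least m. *)
Lemma history_window m rules c cs p s L R x y z q :
  path (moves rules) c cs -> all (fun d => (d.1.2 < m) && (d.2 < m)) (c :: cs) ->
  history m (c :: cs) ++ [:: 0] =
    p ++ [:: m + s, L, R, x, y, z & q] ->
  (0 < size q) -> exists s', x = m + s' /\ moves rules (s, L, R) (s', y, z).
Proof.
elim: cs c p => [|c' cs IH] c p.
  move=> _ _ /(congr1 size); rewrite /history /= !size_cat /=.
  by case: q => //= *; lia.
move=> /= /andP [mv pt] /andP [/andP [lL lR] al] E q0.
have alc := al; move: al => /= /andP [/andP [lL' lR'] _].
case: p E => [|p0 [|p1 [|p2 p]]] /=.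
- case: c mv {lL lR} => -[s0 L0] R0; case: c' {pt alc lL' lR' IH} => -[s1 L1] R1 /=.
  by move=> mv [/addnI <- <- <- <- <- <- _]; exists s1.
- by case=> _ e; move: lL; rewrite e; lia.
- by case=> _ _ e; move: lR; rewrite e; lia.
- by case=> _ _ _ E; apply: (IH c' p).
Qed.

(* The trailing zeros pin down the position of the last configuration: a
   configuration begins with m + s > 0. *)
Lemma window_path m rules fin ns s L R rest p e :
  all (fun r : rule => 0 < r.2.1.1) rules -> 0 < fin -> 0 < s ->
  (forall p s L R x y z q, 0 < s -> 0 < size q ->
     ns = p ++ [:: m + s, L, R, x, y, z & q] ->
     exists s', x = m + s' /\ moves rules (s, L, R) (s', y, z)) ->
  ns = p ++ [:: m + s, L, R & rest] ->
  ns = e ++ [:: 0; 0; m + fin; 0; 0; 0] ->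
  exists cs, path (moves rules) (s, L, R) cs /\ last (s, L, R) cs = (fin, 0, 0).
Proof.
move=> pos fin0 s0 win + Ee.
have [n] := ubnP (size rest); elim: n rest p s L R s0 => // n IH rest p s L R s0 sz Ep.
have := congr1 rev Ep; rewrite Ee.
(* If at most three entries remain, only one remaining entry fits the ending: [m + s] then falls on
   [m + fin], and otherwise on a zero. With four or more, a window is available. *)
case: rest sz Ep => [|x [|y [|z [|u q]]]] sz Ep; rewrite !rev_cat /=.
- by case=> _ _ e1 _; lia.
- by case=> _ <- <- /addnI <- _; exists [::].
- by case=> _ _ _ _ e1 _; lia.
- by case=> _ _ _ _ _ e1 _; lia.
move=> _; have [s' [ex mv]] := win p s L R x y z (u :: q) s0 isT Ep.
have s'0: 0 < s'.
  move: mv => /hasP [r rin /andP [_ /eqP [-> _ _]]].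
  exact: (allP pos).
have [||cs [pt la]] := IH (u :: q) (p ++ [:: m + s; L; R]) s' y z s'0.
- by move: sz => /=; lia.
- by rewrite Ep ex -catA.
by exists ((s', y, z) :: cs); rewrite /= mv pt.
Qed.

(** * The system describing a history *)

Section HistorySystem.
Variables (A : finType) (a b : A).
Variables (rules : seq rule) (pre fin K : nat).

Notation letter c := (inl c).
Notation xv i := (inr (inl i)).
Notation yv j := (inr (inr j)).

Definition form_pattern (V : Type) (v : rule_var -> V) (f : form) : pattern A V :=
  nseq f.1.2 (inr (v f.1.1)) ++ nseq f.2 (inl a).

(** [x 1] becomes [a^m]. The other equations fix both ends of the history [x 2]: it begins with
    [(pre, x 0, x 0)], and ends with two zeros, [(fin, 0, 0)] and one more zero, whose [b] closes
    the last window. *)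
Definition sat_tail : seq (literal A xvar) :=
  [:: EqLit [:: inr 1; inl a] [:: inl a; inr 1];
      EqLit [:: inr 2] (inl b :: inr 1 :: nseq pre (inl a) ++
        [:: inl b; inr 0; inl b; inr 0; inl b; inr 3]);
      EqLit [:: inr 2] ([:: inr 4; inl b; inl b; inl b; inr 1] ++
        nseq fin (inl a) ++ [:: inl b; inl b; inl b])].

(** Only the second state number carries [x 1]: the equation for [x 2] puts [x 1] in front of [y 9],
    whereas [y 12] has to contain it. *)
Definition rule_pattern (r : rule) : pattern A (xvar + yvar) :=
  let f := form_pattern (rule_env (inr 10) (inr 11) (inr 13) (inr 14)) in
  letter b :: nseq r.1.1.1 (letter a) ++ letter b :: f r.1.1.2 ++
  letter b :: f r.1.2 ++ letter b :: xv 1 :: nseq r.2.1.1 (letter a) ++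
  letter b :: f r.2.1.2 ++ letter b :: f r.2.2.

Definition window_pattern : pattern A (xvar + yvar) :=
  [:: letter b; yv 9; letter b; yv 10; letter b; yv 11;
      letter b; yv 12; letter b; yv 13; letter b; yv 14].

(* Here x 1 = a^m, x 2 is the history, and y 9, ..., y 14 are the powers of a in
   two consecutive configurations (s, L, R) and (m + s', L', R').  All the
   literals hold for some y if either no rule relates these two configurations
   (take y 3 = [:: b]), or x 2 contains a letter y 0 other than a and b (take
   y 3 = [::], and y 9, ..., y 14 empty). *)
Definition history_unsat : seq (literal A (xvar + yvar)) :=
  [:: EqLit [:: yv 1; yv 0; yv 2] [seq letter c | c <- enum A & c \notin [:: a; b]];
      EqLit [:: yv 3; yv 4] [:: letter b];
      NeqLit [:: yv 3; yv 0] [::];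
      EqLit [:: xv 2] [:: yv 5; yv 0; yv 6];
      EqLit [:: xv 2] [:: yv 7; yv 3; xv 1; yv 9; yv 3; yv 10; yv 3; yv 11;
                          yv 3; yv 12; yv 3; yv 13; yv 3; yv 14; yv 3; yv 8]] ++
  [seq EqLit [:: yv i; letter a] [:: letter a; yv i] | i <- iota 9 6] ++
  [seq NeqLit window_pattern (rule_pattern r) | r <- rules].

Definition history_system : system A :=
  System (EqLit (nseq K (inl a)) [:: inr 0] :: sat_tail) history_unsat.

Hypothesis ab : a != b.

Lemma subst_form_pattern (V : Type) (h : V -> seq A) (v : rule_var -> V)
    (n : rule_var -> nat) f :
  (forall i, h (v i) = nseq (n i) a) ->
  subst h (form_pattern v f) = nseq (form_val n f) a.
Proof.
by move=> hv; rewrite subst_cat subst_nseq_letter (subst_nseq_var _ (hv _)) -nseqD.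
Qed.

Lemma subst_rule_pattern x y r m L R L' R' :
  x 1 = nseq m a -> y 10 = nseq L a -> y 11 = nseq R a ->
  y 13 = nseq L' a -> y 14 = nseq R' a ->
  let v := form_val (rule_env L R L' R') in
  subst (join x y) (rule_pattern r) =
  blocks a b [:: r.1.1.1; v r.1.1.2; v r.1.2; m + r.2.1.1; v r.2.1.2; v r.2.2].
Proof.
move=> x1 y10 y11 y13 y14 v.
have hv i : join x y (rule_env (inr 10) (inr 11) (inr 13) (inr 14) i) =
    nseq (rule_env L R L' R' i) a by case: i => [[] []].
rewrite /rule_pattern !(subst_form_pattern _ hv, substE) /= x1.
by rewrite !blocks_cons /= cats0 nseqD -!catA.
Qed.

Lemma subst_window_pattern x y S L R X Y Z :
  y 9 = nseq S a -> y 10 = nseq L a -> y 11 = nseq R a ->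
  y 12 = nseq X a -> y 13 = nseq Y a -> y 14 = nseq Z a ->
  subst (join x y) window_pattern = blocks a b [:: S; L; R; X; Y; Z].
Proof.
move=> y9 y10 y11 y12 y13 y14; rewrite /window_pattern !substE /=.
by rewrite y9 y10 y11 y12 y13 y14 !blocks_cons /= !cats0.
Qed.

Lemma history_unsatE x y :
  has (fun f => ~~ satisfies (join x y) f) history_unsat =
  ~~ [&& y 1 ++ y 0 ++ y 2 == [seq c <- enum A | c \notin [:: a; b]],
         y 3 ++ y 4 == [:: b], y 3 ++ y 0 != [::], x 2 == y 5 ++ y 0 ++ y 6,
         x 2 == y 7 ++ y 3 ++ x 1 ++ y 9 ++ y 3 ++ y 10 ++ y 3 ++ y 11 ++
                y 3 ++ y 12 ++ y 3 ++ y 13 ++ y 3 ++ y 14 ++ y 3 ++ y 8,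
         all (fun i => y i ++ [:: a] == a :: y i) (iota 9 6) &
         all (fun r => subst (join x y) window_pattern !=
                       subst (join x y) (rule_pattern r)) rules].
Proof.
rewrite (has_predC (satisfies (join x y))); congr (~~ _).
set no_rule := all (fun r => _ != _) rules.
rewrite /history_unsat !all_cat !all_map [all _ (_ :: _)]/=.
rewrite !substE /= !cats0 -!andbA; do !congr (_ && _);
  by rewrite ?substE /= ?cats0.
Qed.

Lemma history_system_sound :
  all (fun r : rule => (0 < r.1.1.1) && (0 < r.2.1.1)) rules -> 0 < pre -> 0 < fin ->
  satisfiable history_system ->
  exists cs, path (moves rules) (pre, K, K) cs /\ last (pre, K, K) cs = (fin, 0, 0).
Proof.
move=> pos pre0 fin0 [x [/and5P [/eqP e0 /eqP e1 /eqP e2 /eqP e3 _] noviol]].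
move: e0 e1 e2 e3; rewrite !substE /= ?cats0 => /esym x0 /commute_letter.
set m := size _ => x1 e2 e3.
have sub2 : {subset x 2 <= [:: a; b]}.
  move=> c cin; apply: contraT => cab.
  have cin' : c \in [seq d <- enum A | d \notin [:: a; b]].
    by rewrite mem_filter cab mem_enum.
  case/splitPr eX: {1}(x 2) / cin => [u1 u2]; case/splitPr eP: _ / cin' => [v1 v2].
  (* With [y 3] and, by the default of [nth], [y 9] to [y 14] empty, the window reads six zeros. It
     matches no rule, since state numbers are positive. *)
  pose y := nth [::] [:: [:: c]; v1; v2; [::]; [:: b]; u1; u2; [:: b];
    nseq pre a ++ b :: x 0 ++ b :: x 0 ++ b :: x 3].
  have := noviol y; rewrite history_unsatE; apply: contraNT => _.
  rewrite /y /= eP eX !eqxx -{1}eX {1}e2 /= eqxx /=.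
  apply/allP => r rin.
  rewrite (@subst_window_pattern x _ 0 0 0 0 0 0) //.
  rewrite (@subst_rule_pattern x _ r m 0 0 0 0) //.
  apply/eqP => /(blocks_inj ab) [r0 _].
  by have := allP pos r rin; rewrite -r0.
have x2 : exists ns, x 2 = blocks a b ns.
  case: (x 2) sub2 e2 => // c w sub2 [-> _].
  have [|k [ns ->]] := @blocks_ex _ a b w; last by exists (k :: ns).
  by move=> d dw; apply: sub2; rewrite inE dw orbT.
have [ns x2n] := x2.
have [rest nsE] : exists rest, ns = [:: m + pre, K, K & rest].
  have [|k [rest x3]] := @blocks_ex _ a b (x 3).
    move=> d din; apply: sub2.
    by rewrite e2 !(inE, mem_cat) din !orbT.
  exists (k :: rest); apply: (blocks_inj ab).
  by rewrite -x2n e2 x3 x0 x1 !blocks_cons nseqD -!catA.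
(* The first letter of [x 4] is not known; prepending [b] gives a list of blocks, at the price of a
   leading zero. *)
have [e nsE'] : exists e, 0 :: ns = e ++ [:: 0; 0; m + fin; 0; 0; 0].
  have [|k [e x4]] := @blocks_ex _ a b (x 4).
    by move=> d din; apply: sub2; rewrite e3 mem_cat din.
  exists (k :: e); apply: (blocks_inj ab).
  rewrite blocks_cat -x4 blocks_cons -x2n e3 x1 /= !blocks_cons.
  by rewrite nseqD -!catA.
apply: (@window_path m rules fin (0 :: ns) pre K K rest [:: 0] e) => //.
- by apply/allP => r rin; case/andP: (allP pos r rin).
- move=> p s L R X Y Z [//|u q] s0 _ /eqP.
  case: p => [|p0 p]; rewrite /= eqseq_cons => /andP [/eqP p00 /eqP nsp]; first by lia.
  (* These values satisfy all literals except possibly those of the rules, so one of the latter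
     fails, and its rule fires. *)
  pose pi := [seq c <- enum A | c \notin [:: a; b]].
  pose y := nth [::] [:: [::]; pi; [::]; [:: b]; [::]; x 2; [::]; blocks a b p;
    nseq u a ++ blocks a b q; nseq s a; nseq L a; nseq R a;
    nseq X a; nseq Y a; nseq Z a].
  have := noviol y; rewrite history_unsatE /y /= !cats0 !eqxx /=.
  rewrite !(nseq_commute a) !eqxx {1}x2n nsp !blocks_cat !blocks_cons.
  rewrite x1 nseqD -!catA /= eqxx /=.
  rewrite -has_predC => /hasP [r rin /=]; rewrite negbK -/y.
  rewrite (@subst_window_pattern x y s L R X Y Z) //.
  rewrite (@subst_rule_pattern x y r m L R Y Z) //.
  move/eqP/(blocks_inj ab) => [-> eL eR -> eY eZ].
  exists r.2.1.1; split=> //; apply/hasP; exists r => //.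
  by rewrite /fires /side_val /= -eL -eR -eY -eZ !eqxx.
by rewrite nsE.
Qed.

(** The last configuration occurs twice because [sat_tail] wants two zeros before it, the [L] and
    [R] of its predecessor. *)
Lemma history_system_complete c cs :
  c = (pre, K, K) -> path (moves rules) c cs ->
  (exists ds, c :: cs = ds ++ [:: (fin, 0, 0); (fin, 0, 0)]) ->
  satisfiable history_system.
Proof.
move=> cE pt [ds csE].
have [m big] : exists m, all (fun d => (d.1.2 < m) && (d.2 < m)) (c :: cs).
  exists (\max_(d <- c :: cs) maxn d.1.2 d.2).+1; apply/allP => d din.
  rewrite !ltnS -geq_max.
  exact: (@leq_bigmax_seq _ _ xpredT (fun d : conf => maxn d.1.2 d.2)).
pose T := blocks a b (history m (c :: cs) ++ [:: 0]).
have [u3 Tu3] : exists u, T = b :: nseq m a ++ nseq pre a ++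
    b :: nseq K a ++ b :: nseq K a ++ b :: u.
  have [u bu] : exists u, blocks a b (history m cs ++ [:: 0]) = b :: u.
    by case: (cs) => [|d ds']; eexists; rewrite ?blocks_cons.
  by exists u; rewrite /T cE /= !blocks_cons bu nseqD -!catA.
have [u4 Tu4] : exists u,
    T = u ++ [:: b, b, b & nseq m a ++ nseq fin a ++ [:: b; b; b]].
  rewrite /T csE history_cat -catA blocks_cat.
  exists (blocks a b (history m ds) ++ b :: nseq (m + fin) a).
  by rewrite /= !blocks_cons nseqD -!catA /= -!catA.
pose x := nth [::] [:: nseq K a; nseq m a; T; u3; u4].
exists x; split.
  rewrite /= !substE /= !cats0 -Tu3 -Tu4 !eqxx /= andbT.
  by rewrite nseq_commute.
move=> y; rewrite history_unsatE.
apply/negP => /and5P [/eqP ePi /eqP e34 y30 /eqP ew /and3P [/eqP eT comm /allP norule]].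
(* [y 0] is a factor both of [x 2], a word in [a] and [b], and of a word avoiding these letters. *)
have w0 : y 0 = [::].
  case y0E: (y 0) => [//|d w]; exfalso.
  have : d \in x 2 by rewrite ew y0E mem_cat inE eqxx orbT.
  move/mem_blocks => dab.
  have : d \in y 1 ++ y 0 ++ y 2 by rewrite y0E !mem_cat inE eqxx orbT.
  by rewrite ePi mem_filter dab.
have y3 : y 3 = [:: b].
  move: y30 e34; rewrite w0 cats0; case: (y 3) => [//|d [|d' t]] _ //= [-> _] //.
have run i : i \in iota 9 6 -> y i = nseq (size (y i)) a.
  by move=> /(allP comm) /eqP /commute_letter.
have := run 9 isT; have := run 10 isT; have := run 11 isT.
have := run 12 isT; have := run 13 isT; have := run 14 isT => {run}.
move: (size (y 9)) (size (y 10)) (size (y 11)).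
move: (size (y 12)) (size (y 13)) (size (y 14)).
move=> X Y Z S L R y14 y13 y12 y11 y10 y9.
have sub d : d \in y 7 ++ y 8 -> d \in [:: a; b].
  move=> din; have : d \in x 2.
    rewrite eT !mem_cat; move: din.
    by rewrite mem_cat => /orP [] ->; rewrite ?orbT.
  exact: mem_blocks.
have [|k [p y7]] := @blocks_ex _ a b (y 7).
  by move=> d din; apply: sub; rewrite mem_cat din.
have [|u [q y8]] := @blocks_ex _ a b (y 8).
  by move=> d din; apply: sub; rewrite mem_cat din orbT.
have : blocks a b (0 :: history m (c :: cs) ++ [:: 0]) =
    blocks a b (k :: p ++ [:: m + S, L, R, X, Y, Z, u & q]).
  rewrite -(cat_cons k) (blocks_cat _ _ (k :: p)) -y7 -[LHS]/(b :: x 2) eT y3.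
  by rewrite !blocks_cons -(blocks_cons _ _ u) -y8 y9 y10 y11 y12 y13 y14 nseqD -!catA.
move/(blocks_inj ab) => [_ win].
have [//|s' [eX /hasP [r rin fr]]] := history_window pt big win.
have := norule r rin.
rewrite (subst_window_pattern x y9 y10 y11 y12 y13 y14).
rewrite (@subst_rule_pattern x y r m _ _ _ _ erefl y10 y11 y13 y14).
case/andP: fr => /eqP [-> eL eR] /eqP [es eY eZ] /eqP [].
rewrite eX es.
by congr (blocks a b [:: _; _; _; _; _; _]).
Qed.

End HistorySystem.

(** * A Turing machine as a two-stack machine on numbers *)

Section Simulation.
Variables (Sigma : finType) (M : turing_machine Sigma) (al : Sigma).

Notation symbol := (option (Sigma + work M)).

Definition digit (x : symbol) : nat :=
  if x is Some y then (enum_rank y).+1 else 0.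

Definition base : nat := #|{: Sigma + work M}|.+1.

(* The blank has digit 0, so that num does not see the blanks beyond the end. *)
Definition num (s : seq symbol) : nat :=
  foldr (fun x n => base * n + digit x) 0 s.

Definition tape (w : seq Sigma) : seq symbol := [seq Some (inl c) | c <- w].

Lemma digit_lt x : digit x < base.
Proof. by case: x => // y; rewrite ltnS ltn_ord. Qed.

Lemma digit_inj : injective digit.
Proof. by move=> [x|] [y|] //= [] /ord_inj /enum_rank_inj ->. Qed.

Lemma push_inj n n' x x' :
  base * n + digit x = base * n' + digit x' -> n = n' /\ x = x'.
Proof.
move=> E.
have := congr1 (divn^~ base) E.
rewrite /= ![base * _]mulnC !divnMDl // !divn_small ?digit_lt //.
rewrite !addn0 => nn; split=> //; apply: digit_inj.
by move: E; rewrite nn => /addnI.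
Qed.

Lemma num_head_behead s : num s = base * num (behead s) + digit (head None s).
Proof. by case: s => //=; rewrite muln0. Qed.

(* A move to the left is a move to the right followed by two transfers of a
   symbol from the left stack to the right one; [Back1] and [Back2] are the
   states before these transfers. *)
Definition control := (bool + state M * option bool)%type.
Definition Pre : control := inl false.
Definition Fin : control := inl true.
Definition Run q : control := inr (q, None).
Definition Back1 q : control := inr (q, Some true).
Definition Back2 q : control := inr (q, Some false).

(** Numbering from 1 meets the positivity assumptions of [history_system_sound]. *)
Definition control_index (k : control) : nat := enum_rank k + 1.

Definition mconf := (control * nat * nat)%type.

Definition conf_of (c : mconf) : conf := (control_index c.1.1, c.1.2, c.2).

Lemma control_index_inj : injective control_index.
Proof. by move=> k k' /addIn /ord_inj /enum_rank_inj. Qed.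

Definition after_write (q : state M) (d : direction) : control :=
  if d is MoveR then Run q else Back1 q.

(* From (Pre, n, n) the first two rules prepend n copies of [al] to the word of
   number n, and start M. *)
Definition mstep (c d : mconf) : Prop :=
  let: (k, L, R) := c in
  match k with
  | inl false =>
      (exists2 L', L = L'.+1 & d = (Pre, L', base * R + digit (Some (inl al)))) \/
      (L = 0 /\ d = (Run (start M), 0, R))
  | inl true => d = (Fin, 0, 0)
  | inr (q, None) =>
      (q = reject M /\ d = (Fin, 0, 0)) \/
      (q != accept M /\ q != reject M /\ exists x R', R = base * R' + digit x /\
       let: (q', b, dir) := delta q x in
       d = (after_write q' dir, base * L + digit b, R'))
  | inr (q, Some first) =>
      exists x L', L = base * L' + digit x /\
      d = (if first then Back2 q else Run q, L', base * R + digit x)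
  end.

Definition run_rule (q : state M) (x : symbol) : rule :=
  let: (q', b, dir) := delta q x in
  ((control_index (Run q), (OldL, 1, 0), (NewR, base, digit x)),
   (control_index (after_write q' dir), (OldL, base, digit b), (NewR, 1, 0))).

Definition back_rule (k k' : control) (x : symbol) : rule :=
  ((control_index k, (NewL, base, digit x), (OldR, 1, 0)),
   (control_index k', (NewL, 1, 0), (OldR, base, digit x))).

Definition erase_rule (k : control) : rule :=
  ((control_index k, (OldL, 1, 0), (OldR, 1, 0)),
   (control_index Fin, (OldL, 0, 0), (OldR, 0, 0))).

Definition machine_rules : seq rule :=
  [:: ((control_index Pre, (NewL, 1, 1), (OldR, 1, 0)),
       (control_index Pre, (NewL, 1, 0), (OldR, base, digit (Some (inl al)))));
      ((control_index Pre, (OldL, 0, 0), (OldR, 1, 0)),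
       (control_index (Run (start M)), (OldL, 0, 0), (OldR, 1, 0)));
      erase_rule (Run (reject M)); erase_rule Fin] ++
  [seq run_rule q x |
     q <- [seq q <- enum (state M) | (q != accept M) && (q != reject M)],
     x <- enum {: symbol}] ++
  [seq back_rule (Back1 q) (Back2 q) x | q <- enum (state M), x <- enum {: symbol}] ++
  [seq back_rule (Back2 q) (Run q) x | q <- enum (state M), x <- enum {: symbol}].

Lemma control_index_gt0 k : 0 < control_index k.
Proof. by rewrite /control_index addn1. Qed.

Lemma machine_rules_pos :
  all (fun r : rule => (0 < r.1.1.1) && (0 < r.2.1.1)) machine_rules.
Proof.
rewrite !all_cat; apply/and4P; split; first by rewrite /= !control_index_gt0.
all: apply/allP => r /allpairsP [[q x] /= [_ _ ->]]; rewrite ?control_index_gt0 //.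
by rewrite /run_rule; case: (delta q x) => [[q' b] dir]; rewrite !control_index_gt0.
Qed.

Lemma movesP c d' :
  moves machine_rules (conf_of c) d' <-> exists2 d, d' = conf_of d & mstep c d.
Proof.
have simp := (mul1n, mul0n, addn0, addn1).
case: c => [[k L] R]; case: d' => [[s' L'] R']; split.
  rewrite /moves !has_cat => /or4P [].
  - case/or4P=> [||| /orP [|//]] /andP [] /eqP [/control_index_inj ->];
      rewrite /form_val /rule_env /= ?simp.
    + move=> eL _ /eqP []; rewrite /form_val /= ?simp => -> _ ->.
      exists (Pre, L', base * R + digit (Some (inl al))) => //.
      by left; exists L'.
    + move=> -> _ /eqP []; rewrite /form_val /= ?simp => -> -> ->.
      by exists (Run (start M), 0, R) => //; right.
    + move=> _ _ /eqP []; rewrite /form_val /= ?simp => -> -> ->.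
      by exists (Fin, 0, 0) => //; left.
    + move=> _ _ /eqP []; rewrite /form_val /= ?simp => -> -> ->.
      by exists (Fin, 0, 0).
  - case/hasP => r /allpairsP [[q x] /= [qin _ ->]].
    move: qin; rewrite mem_filter => /andP [/andP [qa qr] _].
    rewrite /run_rule; case E: (delta q x) => [[q' b] dir].
    case/andP => /eqP [/control_index_inj -> _ eR] /eqP [-> eL _].
    exists (after_write q' dir, L', R'); first by [].
    right; split=> //; split=> //; exists x, R'; rewrite E.
    by split; rewrite // eL.
  - case/hasP => r /allpairsP [[q x] /= [_ _ ->]].
    case/andP => /eqP [/control_index_inj -> eL _] /eqP [-> _ eR].
    exists (Back2 q, L', R'); first by [].
    by exists x, L'; rewrite eR.
  - case/hasP => r /allpairsP [[q x] /= [_ _ ->]].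
    case/andP => /eqP [/control_index_inj -> eL _] /eqP [-> _ eR].
    exists (Run q, L', R'); first by [].
    by exists x, L'; rewrite eR.
case=> d -> st; apply/hasP; move: st.
have fire r : conf_of (k, L, R) = side_val (rule_env L R d.1.2 d.2) r.1 ->
    conf_of d = side_val (rule_env L R d.1.2 d.2) r.2 ->
    fires (conf_of (k, L, R)) (conf_of d) r.
  by move=> e1 e2; rewrite /fires -e1 -e2 !eqxx.
case: k fire => [[]|[q [first|]]] fire /=.
- move=> dE; exists (erase_rule Fin); first by rewrite !inE eqxx !orbT.
  by apply: fire; rewrite dE /side_val /form_val /= ?simp.
- case=> [[L0 LE dE]|[LE dE]].
    exists (nth (erase_rule Fin) machine_rules 0); first by rewrite mem_nth.
    by apply: fire; rewrite dE LE /side_val /form_val /= ?simp.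
  exists (nth (erase_rule Fin) machine_rules 1); first by rewrite mem_nth.
  by apply: fire; rewrite dE LE /side_val /form_val /= ?simp.
- case=> x [L0 [LE dE]].
  exists (if first then back_rule (Back1 q) (Back2 q) x
          else back_rule (Back2 q) (Run q) x).
    rewrite !mem_cat; apply/or4P; case: first {fire dE}; [constructor 3|constructor 4];
      by apply/allpairsP; exists (q, x); rewrite !mem_enum.
  by apply: fire; rewrite dE LE; case: first {dE}; rewrite /side_val /form_val /= ?simp.
case=> [[qE dE]|[qa [qr [x [R0 [RE]]]]]].
  exists (erase_rule (Run (reject M))); first by rewrite !inE eqxx !orbT.
  by apply: fire; rewrite ?dE ?qE /side_val /form_val /= ?simp.
case E: (delta q x) => [[q' b] dir] dE; exists (run_rule q x).
  rewrite !mem_cat; apply/or4P; constructor 2; apply/allpairsP.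
  by exists (q, x); rewrite mem_filter !mem_enum qa qr.
by apply: fire; rewrite ?dE ?RE /run_rule E /side_val /form_val /= ?simp.
Qed.

(** * Agreement of the two machines *)

Variable w0 : seq Sigma.

Definition word_num := num (tape w0).
Definition input := nseq word_num al ++ w0.

Definition run_config n : config M := iter n (@step Sigma M) (init M input).

(** In a [Back] state the run has already moved left, and the stacks lag behind it by two transfers
    or by one. *)
Definition invariant (c : mconf) : Prop :=
  let: (k, L, R) := c in
  match k with
  | inl false => exists2 j, L + j = word_num & R = num (tape (nseq j al ++ w0))
  | inl true => rejects M input
  | inr (q, None) => exists n l r,
      [/\ run_config n = Config q l r, L = num l & R = num r]
  | inr (q, Some first) => exists n l b r,
      run_config n = Config q (behead l) (head None l :: b :: r) /\
      if first then L = num (b :: l) /\ R = num r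
      else L = num l /\ R = num (b :: r)
  end.

(** By [push_inj] a pop has a single outcome, the blank on an empty stack, so each step is forced to
    follow the run. *)
Lemma mstep_invariant c d : mstep c d -> invariant c -> invariant d.
Proof.
case: c => [[[[]|[q [first|]]] L] R] /=.
- by move=> -> .
- case=> [[L0 -> ->]|[-> ->]] [j].
    by move=> Lj RE; exists j.+1; rewrite -?Lj ?addSnnS // RE.
  rewrite add0n => -> ->; exists 0, [::], (tape input); split=> //.
- case=> x [L0 [LE ->]] [n [l [b [r [runE]]]]].
  case: first runE => runE []; rewrite LE => eL ->.
    by case/push_inj: eL => -> ->; exists n, l, b, r.
  move: eL; rewrite num_head_behead => /push_inj [-> ->].
  by exists n, (behead l), (head None l :: b :: r).
case=> [[-> ->] [n [l [r [runE _ _]]]]|].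
  by exists n; rewrite -/(run_config n) runE.
case=> qa [qr [x [R0 [-> E]]]] [n [l [r [runE LE]]]].
rewrite num_head_behead => /push_inj [R0E xE].
have stepE : run_config n.+1 = let: (q', b, d) := delta q x in
    match d with
    | MoveR => Config q' (b :: l) (behead r)
    | MoveL => Config q' (behead l) (head None l :: b :: behead r)
    end.
  by rewrite /run_config iterS -/(run_config n) runE /step /halted /= -xE
             (negbTE qa) (negbTE qr).
move: E stepE; case: (delta q x) => [[q' b] []] -> stepE /=; rewrite LE.
  by exists n.+1, l, b, (behead r); rewrite stepE R0E.
by exists n.+1, (b :: l), (behead r); rewrite stepE R0E.
Qed.

Lemma moves_sound cs c :
  invariant c -> path (moves machine_rules) (conf_of c) cs ->
  last (conf_of c) cs = (control_index Fin, 0, 0) -> rejects M input.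
Proof.
elim: cs c => [|d' cs IH] c inv /=.
  case: c inv => [[k L] R] inv _ [] /control_index_inj kE _ _.
  by move: inv; rewrite kE.
case/andP => /movesP [d -> st]; apply: IH; exact: mstep_invariant st inv.
Qed.

Definition reach (c d : mconf) : Prop :=
  exists cs, path (moves machine_rules) (conf_of c) cs /\
             last (conf_of c) cs = conf_of d.

Lemma reach_step c d e : reach c d -> mstep d e -> reach c e.
Proof.
move=> [cs [pt la]] st; exists (rcons cs (conf_of e)).
rewrite rcons_path pt last_rcons la; split=> //.
by apply/movesP; exists e.
Qed.

Lemma reach_start :
  reach (Pre, word_num, word_num) (Run (start M), 0, num (tape input)).
Proof.
suff pre j L : L + j = word_num ->
    reach (Pre, word_num, word_num) (Pre, L, num (tape (nseq j al ++ w0))).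
  apply: reach_step (pre word_num 0 (add0n word_num)) _; right; split=> //.
elim: j L => [|j IH] L.
  by rewrite addn0 => ->; exists [::].
rewrite addnS -addSn => /IH r; apply: reach_step r _.
by left; exists L.
Qed.

Lemma reach_run n : reach (Pre, word_num, word_num)
  (Run (current (run_config n)), num (tape_left (run_config n)),
   num (tape_right (run_config n))).
Proof.
elim: n => [|n IH]; first exact: reach_start.
move: IH; rewrite /run_config iterS -/(run_config n).
case: (run_config n) => q l r /= IH; rewrite /step.
case: ifP => // /negbT; rewrite /halted [current _]/= negb_or => /andP [qa qr].
pose s := head None r; pose R := num (behead r).
have rE : num r = base * R + digit s := num_head_behead r.
case E: (delta q s) => [[q' b] dir].
have st : mstep (Run q, num l, num r) (after_write q' dir, base * num l + digit b, R).
  by right; split=> //; split=> //; exists s, R; rewrite E.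
have := reach_step IH st; case: dir {E st} => //= reach1.
have st1 : mstep (Back1 q', num (b :: l), R) (Back2 q', num l, num (b :: behead r)).
  by exists b, (num l).
apply: reach_step (reach_step reach1 st1) _.
by exists (head None l), (num (behead l)); rewrite -num_head_behead.
Qed.

Lemma reach_rejects : rejects M input -> reach (Pre, word_num, word_num) (Fin, 0, 0).
Proof.
move=> [n rej]; apply: reach_step (reach_run n) _.
by left; rewrite /run_config rej.
Qed.

Section Encoded.
Variables (A : finType) (a b : A).
Hypothesis ab : a != b.

Definition machine_system : system A :=
  history_system a b machine_rules (control_index Pre) (control_index Fin) word_num.

Lemma machine_systemP : satisfiable machine_system <-> rejects M input.
Proof.
split.
  move=> sat; have [cs [pt la]] := history_system_sound ab machine_rules_pos
    (control_index_gt0 _) (control_index_gt0 _) sat.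
  have inv : invariant (Pre, word_num, word_num) by exists 0; rewrite ?addn0.
  exact: moves_sound inv pt la.
case/reach_rejects => cs [pt la].
(* The loop at [Fin] supplies the repeated last configuration. *)
have stop : moves machine_rules (conf_of (Fin, 0, 0)) (conf_of (Fin, 0, 0)).
  by apply/movesP; exists (Fin, 0, 0).
apply: (history_system_complete ab (c := conf_of (Pre, word_num, word_num))
  (cs := rcons cs (conf_of (Fin, 0, 0)))) => //.
  by rewrite rcons_path pt la.
exists (belast (conf_of (Pre, word_num, word_num)) cs).
by rewrite -rcons_cons lastI la -!cats1 -catA.
Qed.

End Encoded.
End Simulation.

(** * A system that refers to its own code *)

(** Letters code themselves, so [n] affects only the length of the prefix of the code. *)
Lemma code_system_letters (A : finType) (a : A) n u es fs :
  code_system (System (EqLit (nseq n (inl a)) u :: es) fs) =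
  nseq n (inl a) ++ code_system (System (EqLit [::] u :: es) fs).
Proof.
have patE : code_pattern (@code_xvar A) (nseq n (inl a)) = nseq n (inl a).
  by elim: n => //= n IH; rewrite /code_pattern /= -IH.
by rewrite /code_system /= patE -!catA /= -!catA.
Qed.

(** Halted configurations are fixed by [step], so both runs agree after [n + n'] steps. *)
Lemma accepts_rejects (Sigma : finType) (M : turing_machine Sigma) w :
  accepts M w -> rejects M w -> False.
Proof.
move=> [n acc] [n' rej].
have halt c : halted c -> forall j, iter j (@step _ M) c = c.
  by move=> hc; elim=> //= j ->; rewrite /step hc.
have ha : halted (iter n (@step _ M) (init M w)) by rewrite /halted acc eqxx.
have hr : halted (iter n' (@step _ M) (init M w)) by rewrite /halted rej eqxx orbT.
have := accept_neq_reject M; rewrite -acc -rej.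
have -> : iter n (@step _ M) (init M w) = iter n' (@step _ M) (init M w).
  by rewrite -(halt _ ha n') -(halt _ hr n) -!iterD addnC.
by rewrite eqxx.
Qed.

Theorem mainTheorem4 (A : finType) (hA : 2 <= #|A|) :
  ~ turing_decidable (@code_system A) (@satisfiable A).
Proof.
case=> M dec.
have [a [b ab]] : exists a b : A, a != b.
  by have /card_gt1P [a [b [_ _ ab]]] := hA; exists a, b.
pose al : A + marker := inl a.
(* The rules depend on [M] and [al] only, so there is no circularity: [K = 0] gives the part [w0] of
   the code common to all [K], and then [K] is set to the number of [w0]. *)
pose tail := history_system a b (machine_rules M al)
  (control_index (Pre M)) (control_index (Fin M)) 0.
pose w0 := code_system tail.
pose s := machine_system M al w0 a b.
have codeE : code_system s = input M al w0.
  exact: code_system_letters.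
have [yes no] := dec s; rewrite codeE in yes no.
have sP := machine_systemP M al w0 ab.
have nsat : ~ satisfiable s.
  by move=> sat; exact: accepts_rejects (yes sat) (sP.1 sat).
exact: nsat (sP.2 (no nsat)).
Qed.
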